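(* Both of the following statements are false: (i) for all finite sets of formulas $\Gamma$, all formulas $A$ and all $\mathfrak{B}\in\mathbb{B}^2$, $\Gamma\models^s_{\mathfrak{B},2}A$ implies $\Gamma\models^\alpha_{\mathfrak{B},2}A$; (ii) for all finite sets of formulas $\Gamma$, all formulas $A$ and all $\mathfrak{B}\in\mathbb{B}^2$, $\Gamma\models^\alpha_{\mathfrak{B},2}A$ implies $\Gamma\models^s_{\mathfrak{B},2}A$.
   Context: LANGUAGE. $\mathscr{L}$ is the propositional language whose formulas are built from infinitely many propositional letters and the atomic constant $\bot$ by $\wedge,\vee,\rightarrow$; $\neg X := X \rightarrow \bot$. $\mathrm{ATOM}$ is the set of the letters together with $\bot$. $\Gamma,\Delta$ always range over finite sets of formulas. ATOMIC RULES. A rule of level $0$ is an atom (an axiom). A rule of level $1$ infers an atom $A$ from atoms $A_1,\dots,A_m$. For $k\ge 1$, if $\Re_1,\dots,\Re_m$ are finite sets of atomic rules (some possibly empty) of maximal level $k-1$, then $([\Re_1]A_1,\dots,[\Re_m]A_m)/A$, which infers the atom $A$ from the atoms $A_1,\dots,A_m$ and discharges the rules in $\Re_i$ in the derivation of the $i$-th premise, is a rule of level $k+1$. ATOMIC BASES. An atomic base is a (possibly infinite) set $\mathfrak{B}$ of atomic rules containing the explosion rule $\bot/A$ for every atom $A$; its level is the maximal level of its rules other than the explosion rules ($0$ if there are none). $\mathbb{B}^n$ is the set of bases of level $\le n$. $\mathfrak{C}\supseteq_n\mathfrak{B}$ means $\mathfrak{C}\supseteq\mathfrak{B}$ and $\mathfrak{C}\in\mathbb{B}^n$.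 Derivations in $\mathfrak{B}$ are defined inductively: an atom $A$ is a single-node derivation of $A$, from no assumed rules if the axiom $A\in\mathfrak{B}$ is applied, and from the assumed rule $A$ if $A$ is assumed; if $\mathscr{D}_i$ derives $A_i$ from assumed rules $\mathfrak{C}_i\cup\Re_i$ ($i\le m$), then applying $R=([\Re_1]A_1,\dots,[\Re_m]A_m)/A$ yields a derivation of $A$ from $\bigcup_i\mathfrak{C}_i$ if $R\in\mathfrak{B}$, and from $\bigcup_i\mathfrak{C}_i\cup\{R\}$ if $R\notin\mathfrak{B}$. $\vdash_{\mathfrak{B}}A$ means that there is a derivation of $A$ in $\mathfrak{B}$ from no assumed rules (a closed derivation). SANDQVIST'S BASE SEMANTICS. For $\mathfrak{B}\in\mathbb{B}^n$, define: for $A\in\mathrm{ATOM}$, $\models^s_{\mathfrak{B},n}A$ iff $\vdash_{\mathfrak{B}}A$; $\models^s_{\mathfrak{B},n}B\wedge C$ iff $\models^s_{\mathfrak{B},n}B$ and $\models^s_{\mathfrak{B},n}C$; $\models^s_{\mathfrak{B},n}B\vee C$ iff for all $\mathfrak{C}\supseteq_n\mathfrak{B}$ and all $D\in\mathrm{ATOM}$, if $B\models^s_{\mathfrak{C},n}D$ and $C\models^s_{\mathfrak{C},n}D$ then $\models^s_{\mathfrak{C},n}D$; $\models^s_{\mathfrak{B},n}B\rightarrow C$ iff $B\models^s_{\mathfrak{B},n}C$; for $\Gamma\ne\emptyset$, $\Gamma\models^s_{\mathfrak{B},n}A$ iff for all $\mathfrak{C}\supseteq_n\mathfrak{B}$,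 if $\models^s_{\mathfrak{C},n}B$ for all $B\in\Gamma$ then $\models^s_{\mathfrak{C},n}A$. REDUCIBILITY SEMANTICS. An argument structure $\mathscr{D}=\langle T,\langle f,h,g\rangle\rangle$ consists of a finite rooted tree $T$ with nodes labelled by formulas ($\mu\prec\nu$ means that $\nu$ lies below $\mu$, towards the root), whose leaves are partitioned into assumption leaves $\mathrm{as}(T)$ and axiom leaves $\mathrm{ax}(T)$, and of partial discharge functions: $f$ is defined on a subset of $\mathrm{as}(T)$ with $\mu\prec f(\mu)$; $h$ is defined on a subset of $\mathrm{ax}(T)$ with $\mu\prec h(\mu)$, where $h(\mu)$ and its children are labelled by atoms and $h(\mu)$ is not a value of $f$; $g$ is defined on a set of sets $K$ of edges, each $K$ consisting of all and only the edges linking a node $\mu_K$ to its children, where $\mu_K$ and its children are labelled by atoms, $\mu_K$ is not a value of $f$, $\mu_K\prec g(K)$, $g(K)$ and its children are labelled by atoms, and $g(K)$ is not a value of $f$. ($f$ discharges assumptions; $h$ and $g$ discharge assumed atomic rules of level $0$ and higher.) The root label is the conclusion. $\mathscr{D}$ is from $\Gamma$ to $A$ if $\Gamma$ is the set of its undischarged assumptions and $A$ its conclusion; it is closed if $\Gamma=\emptyset$, open otherwise. Derivations in $\mathfrak{B}$ are regarded as argument structures with all labels atomic and $f$ empty. $\mathscr{D}[\mathscr{D}^{**}/\mathscr{D}^*]$ is the result of replacing the sub-structure $\mathscr{D}^*$ by $\mathscr{D}^{**}$ in $\mathscr{D}$, the discharge functions being redefined in the natural way (discharges of surviving or copied assumptions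 and assumed rules take place at the corresponding nodes; the others disappear). If $\mathscr{D}$ is from $\Gamma=\{\mu_1,\dots,\mu_m\}$ and $\sigma$ assigns to each $\mu_i$ an argument structure $\sigma(\mu_i)$ with the same conclusion as $\mu_i$, then $\mathscr{D}^\sigma=\mathscr{D}[\sigma(\mu_1),\dots,\sigma(\mu_m)/\mu_1,\dots,\mu_m]$; it is a closed $\sigma$-instance if all $\sigma(\mu_i)$ are closed. An inference is a triple $\langle\langle\mathscr{D}_1,\dots,\mathscr{D}_m\rangle,A,\delta\rangle$ with $\delta$ an extension of the discharge functions of the $\mathscr{D}_i$; its associated argument structure joins the trees of the $\mathscr{D}_i$ by a new root $A$ and adds the discharges $\delta$. A rule is a (recursive) set of inferences, its instances. Introduction rules are Gentzen's: $A,B/A\wedge B$; $A_i/A_1\vee A_2$ ($i=1,2$); $[A]B/A\rightarrow B$. $\mathscr{D}$ is canonical if it is associated to an instance of an introduction rule. A reduction for a rule $R$ is a map $\phi$ from and to argument structures, defined on some set $\mathbb{D}$ of argument structures associated to instances of $R$, such that for all $\mathscr{D}\in\mathbb{D}$: (a) if $\mathscr{D}$ is from $\Gamma$ to $A$, then $\phi(\mathscr{D})$ is from some $\Gamma^*\subseteq\Gamma$ to $A$; (b) for all $\sigma$, $\phi$ is defined on $\mathscr{D}^\sigma$ and $\phi(\mathscr{D}^\sigma)=\phi(\mathscr{D})^\sigma$. For a set $\mathfrak{J}$ of reductions, $\mathscr{D}\leq_{\mathfrak{J}}\mathscr{D}^*$ is the reflexive-transitive closure of: $\mathscr{D}^*=\mathscr{D}[\phi(\mathscr{D}^{**})/\mathscr{D}^{**}]$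 for some sub-structure $\mathscr{D}^{**}$ of $\mathscr{D}$ and some $\phi\in\mathfrak{J}$. An argument is a pair $\langle\mathscr{D},\mathfrak{J}\rangle$. It is $n$-valid on $\mathfrak{B}\in\mathbb{B}^n$ iff: when $\mathscr{D}$ is closed with atomic conclusion, $\mathscr{D}\leq_{\mathfrak{J}}\mathscr{D}^*$ for some closed derivation $\mathscr{D}^*$ in $\mathfrak{B}$; when $\mathscr{D}$ is closed with non-atomic conclusion, $\mathscr{D}\leq_{\mathfrak{J}}\mathscr{D}^*$ for some canonical $\mathscr{D}^*$ whose immediate sub-structures, paired with $\mathfrak{J}$, are $n$-valid on $\mathfrak{B}$; when $\mathscr{D}$ is open with undischarged assumptions $\Gamma$, for all $\sigma$ assigning closed structures, all sets of reductions $\mathfrak{J}^+\supseteq\mathfrak{J}$ and all $\mathfrak{C}\supseteq_n\mathfrak{B}$, if $\langle\sigma(\mu),\mathfrak{J}^+\rangle$ is $n$-valid on $\mathfrak{C}$ for all $\mu\in\Gamma$, then $\langle\mathscr{D}^\sigma,\mathfrak{J}^+\rangle$ is $n$-valid on $\mathfrak{C}$. $\Gamma\models^\alpha_{\mathfrak{B},n}A$ means that some argument $\langle\mathscr{D},\mathfrak{J}\rangle$ with $\mathscr{D}$ from $\Gamma$ to $A$ is $n$-valid on $\mathfrak{B}$. *)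

(* Defs.v *)
From HB Require Import structures.
From mathcomp Require Import all_boot.
From mathcomp Require Import finmap.
From Stdlib Require List.
From Stdlib Require Import Relation_Operators.

Set Implicit Arguments.
Unset Strict Implicit.
Unset Printing Implicit Defensive.

Local Open Scope fset_scope.

(** * Language *)

Inductive atom := Bot | Letter of nat.

Definition atom_code (a : atom) := if a is Letter p then Some p else None.
Definition atom_decode (x : option nat) := if x is Some p then Letter p else Bot.
Lemma atom_codeK : cancel atom_code atom_decode. Proof. by case. Qed.
HB.instance Definition _ := Countable.copy atom (can_type atom_codeK).

Inductive formula :=
  | Atom of atom
  | And of formula & formula
  | Or of formula & formula
  | Imp of formula & formula.

Fixpoint formula_code (A : formula) : GenTree.tree atom :=
  match A with
  | Atom a => GenTree.Leaf a
  | And B C => GenTree.Node 0 [:: formula_code B; formula_code C]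
  | Or B C => GenTree.Node 1 [:: formula_code B; formula_code C]
  | Imp B C => GenTree.Node 2 [:: formula_code B; formula_code C]
  end.
Fixpoint formula_decode (t : GenTree.tree atom) : formula :=
  match t with
  | GenTree.Leaf a => Atom a
  | GenTree.Node 0 [:: t; u] => And (formula_decode t) (formula_decode u)
  | GenTree.Node 1 [:: t; u] => Or (formula_decode t) (formula_decode u)
  | GenTree.Node 2 [:: t; u] => Imp (formula_decode t) (formula_decode u)
  | _ => Atom Bot
  end.
Lemma formula_codeK : cancel formula_code formula_decode.
Proof. by elim=> //= A -> B ->. Qed.
HB.instance Definition _ := Countable.copy formula (can_type formula_codeK).

Definition Neg (A : formula) := Imp A (Atom Bot).

Definition is_atom (A : formula) : bool := if A is Atom _ then true else false.
Definition atom_of (A : formula) : atom := if A is Atom a then a else Bot.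

(** * Atomic rules and bases *)

(* [Rule [:: (Rs_1, A_1); ...; (Rs_m, A_m)] A] is the rule
   ([Rs_1] A_1, ..., [Rs_m] A_m) / A; for m = 0 it is the axiom A. *)
Inductive arule := Rule of seq (seq arule * atom) & atom.

Definition axiom (a : atom) : arule := Rule [::] a.
Definition explosion (a : atom) : arule := Rule [:: ([::], Bot)] a.

(* 0 for axioms, 1 if nothing is discharged, and otherwise 2 plus the maximal
   level of the discharged rules. *)
Fixpoint level (R : arule) : nat :=
  let: Rule ps _ := R in
  foldr maxn 0 [seq foldr maxn 1 [seq (level Q).+2 | Q <- p.1] | p <- ps].

(* The discharged rules form finite sets, represented by lists: [rule_eq]
   identifies two rules that differ only in the choice of such lists,
   hereditarily. *)
Fixpoint rule_eq (R S : arule) {struct R} : bool :=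
  let: Rule ps a := R in
  let: Rule qs b := S in
  (a == b) &&
  all2 (fun p q : seq arule * atom =>
          [&& p.2 == q.2,
              all (fun r => has (rule_eq r) q.1) p.1
            & all (fun s => has (fun r => rule_eq r s) p.1) q.1]) ps qs.

Record base := Base {
  in_base :> arule -> Prop;
  base_explosion : forall a, in_base (explosion a);
  base_ext : forall R S, rule_eq R S -> in_base R -> in_base S
}.

Definition base_level_le (n : nat) (B : base) : Prop :=
  forall R, B R -> (forall a, R <> explosion a) -> level R <= n.

Definition extends (n : nat) (C B : base) : Prop :=
  (forall R, B R -> C R) /\ base_level_le n C.

(** * Argument structures *)

(* Finite trees with discharge pointers.  A node [Infer A d Ds] without
   children is an axiom leaf.  The pointer of an assumption leaf is the value
   of f there; the pointer of an [Infer] node is the value of h there if the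
   node is an axiom leaf, and the value of g at the set of its edges to its
   children otherwise.  [Some k] denotes the node k + 1 edges closer to the
   root ([Some 0] is the parent); [None] means that the function is undefined.
   As h and g discharge assumed atomic rules, [wf] below allows them only at nodes
   labelled by atoms.
   In a subtree of a structure, pointers may lead outside of the subtree. *)
Inductive structure :=
  | Assume of formula & option nat
  | Infer of formula & option nat & seq structure.

Lemma structure_nested_ind (P : structure -> Prop) :
  (forall A f, P (Assume A f)) ->
  (forall A d Ds, (forall D, List.In D Ds -> P D) -> P (Infer A d Ds)) ->
  forall D, P D.
Proof.
move=> PA PI; fix IH 1; case=> [A f|A d Ds]; first exact: PA.
apply: PI; elim: Ds => [|E Es IHs] D; first by case.
by case=> [<-|]; [exact: IH | exact: IHs].
Qed.

Fixpoint structure_code (D : structure) : GenTree.tree (formula * option nat) :=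
  match D with
  | Assume A f => GenTree.Leaf (A, f)
  | Infer A d Ds =>
      GenTree.Node 0 (GenTree.Leaf (A, d) :: [seq structure_code E | E <- Ds])
  end.
Fixpoint structure_decode (t : GenTree.tree (formula * option nat)) : structure :=
  match t with
  | GenTree.Leaf (A, f) => Assume A f
  | GenTree.Node _ (GenTree.Leaf (A, d) :: ts) =>
      Infer A d [seq structure_decode u | u <- ts]
  | GenTree.Node _ _ => Assume (Atom Bot) None
  end.
Lemma structure_codeK : cancel structure_code structure_decode.
Proof.
elim/structure_nested_ind => //= A d Ds IH; congr (Infer _ _ _).
elim: Ds IH => //= E Es IHs IH; congr (_ :: _); first by apply: IH; left.
by apply: IHs => D HD; apply: IH; right.
Qed.
HB.instance Definition _ := Countable.copy structure (can_type structure_codeK).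

Definition conclusion (D : structure) : formula :=
  match D with Assume A _ => A | Infer A _ _ => A end.

(* The labels of the assumption leaves of D discharged at the node pointed at
   by [Some k] from the root of D. *)
Fixpoint discharged_at (k : nat) (D : structure) : seq formula :=
  match D with
  | Assume A f => if f == Some k then [:: A] else [::]
  | Infer _ _ Ds => flatten [seq discharged_at k.+1 E | E <- Ds]
  end.

(* The rule applied at a node discharges, for each premise, the rules assumed
   above that premise whose pointer leads to the node. *)
Definition rule_applied (discharged : structure -> seq arule) (A : formula)
    (Ds : seq structure) : arule :=
  Rule [seq (discharged E, atom_of (conclusion E)) | E <- Ds] (atom_of A).

(* The rules assumed in D and discharged at the node pointed at by [Some k]. *)
Fixpoint rules_discharged_at (k : nat) (D : structure) : seq arule :=
  match D with
  | Assume _ _ => [::]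
  | Infer A d Ds =>
      (if d == Some k then [:: rule_applied (rules_discharged_at 0) A Ds] else [::])
      ++ flatten [seq rules_discharged_at k.+1 E | E <- Ds]
  end.

(* The node with label A and sub-trees Ds is labelled by an atom, as are its
   children, and is not a value of f. *)
Definition rule_node (A : formula) (Ds : seq structure) : bool :=
  [&& is_atom A, all (fun E => is_atom (conclusion E)) Ds
    & all (fun E => nilp (discharged_at 0 E)) Ds].

(* [wf [::] D] holds iff D is an argument structure; in general [env] tells for
   each node between D and the root, innermost first, if it is a [rule_node]. *)
Fixpoint wf (env : seq bool) (D : structure) : bool :=
  match D with
  | Assume _ f => if f is Some k then k < size env else true
  | Infer A d Ds =>
      (if d is Some k then nth false env k && rule_node A Ds else true)
      && all (wf (rule_node A Ds :: env)) Ds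
  end.

(* Where a pointer leads, seen from the root of a subtree k nodes below:
   [None] if it stays in the subtree. *)
Definition outer (k : nat) (d : option nat) : option (option nat) :=
  match d with
  | None => Some None
  | Some j => if j < k then None else Some (Some (j - k))
  end.

(* The assumptions undischarged in the sub-structure given by the subtree D, each
   with its discharge in the whole structure; k is the number of nodes from the
   root of the sub-structure down to the parent of D, and 0 at that root. *)
Fixpoint open_assumptions (k : nat) (D : structure) : seq (formula * option nat) :=
  match D with
  | Assume A f => if outer k f is Some o then [:: (A, o)] else [::]
  | Infer _ _ Ds => flatten [seq open_assumptions k.+1 E | E <- Ds]
  end.

(* Likewise for the applications of atomic rules which can be discharged. *)
Fixpoint open_rules (k : nat) (D : structure) : seq (arule * option nat) :=
  match D with
  | Assume _ _ => [::]
  | Infer A d Ds =>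
      (if rule_node A Ds then
         if outer k d is Some o then
           [:: (rule_applied (rules_discharged_at 0) A Ds, o)] else [::]
       else [::])
      ++ flatten [seq open_rules k.+1 E | E <- Ds]
  end.

(* [trunc 0 D] is the sub-structure given by the subtree D of a structure:
   what is discharged outside of D is undischarged in it. *)
Fixpoint trunc (k : nat) (D : structure) : structure :=
  match D with
  | Assume A f => Assume A (if outer k f is None then f else None)
  | Infer A d Ds =>
      Infer A (if outer k d is None then d else None) [seq trunc k.+1 E | E <- Ds]
  end.

Definition assumptions (D : structure) : {fset formula} :=
  [fset x.1 | x in open_assumptions 0 D].

Definition closed (D : structure) : bool := assumptions D == fset0.

(* All undischarged assumptions with the same label are replaced by the same
   structure.  Pointers inside of the [s A] stay there, so no renaming is needed. *)
Fixpoint subst (s : formula -> structure) (D : structure) : structure :=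
  match D with
  | Assume A None => s A
  | Assume A (Some k) => Assume A (Some k)
  | Infer A d Ds => Infer A d [seq subst s E | E <- Ds]
  end.

Definition assignment (s : formula -> structure) (G : {fset formula}) : Prop :=
  forall A, A \in G -> wf [::] (s A) /\ conclusion (s A) = A.

(** * Derivations *)

(* [derivation B env D]: D is a derivation in B whose assumed rules are
   discharged at nodes of D or at nodes below D; [nth [::] env k] is the set of
   rules which the node pointed at by [Some k] discharges on the branch of D.
   The list [Rs] of a premise may contain rules that are not assumed above it. *)
Inductive derivation (B : base) : seq (seq arule) -> structure -> Prop :=
  Derivation env (ps : seq (seq arule * atom)) (a : atom) d (Ds : seq structure) :
    match d with
    | None => B (Rule ps a)
    | Some k => (ps = [::] \/ ~ B (Rule ps a)) /\
                has (rule_eq (Rule ps a)) (nth [::] env k)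
    end ->
    List.Forall2 (fun p E => conclusion E = Atom p.2 /\ derivation B (p.1 :: env) E)
      ps Ds ->
    derivation B env (Infer (Atom a) d Ds).

Definition derivable (B : base) (a : atom) : Prop :=
  exists2 D, derivation B [::] D & conclusion D = Atom a.

(** * Sandqvist's semantics *)

Fixpoint s_valid (n : nat) (B : base) (A : formula) {struct A} : Prop :=
  match A with
  | Atom a => derivable B a
  | And X Y => s_valid n B X /\ s_valid n B Y
  | Or X Y =>
      forall C a, extends n C B ->
        (forall E, extends n E C -> s_valid n E X -> derivable E a) ->
        (forall E, extends n E C -> s_valid n E Y -> derivable E a) ->
        derivable C a
  | Imp X Y => forall C, extends n C B -> s_valid n C X -> s_valid n C Y
  end.

Definition s_consequence (n : nat) (B : base) (G : {fset formula}) (A : formula) : Prop :=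
  if G == fset0 then s_valid n B A
  else forall C, extends n C B ->
         (forall X, X \in G -> s_valid n C X) -> s_valid n C A.

(** * Rules and reductions *)

(* The total recursive functions; only the values on lists of length n matter. *)
Inductive recursive : nat -> (seq nat -> nat) -> Prop :=
  | Rec_zero n : recursive n (fun=> 0)
  | Rec_succ : recursive 1 (fun x => (head 0 x).+1)
  | Rec_proj n i : i < n -> recursive n (fun x => nth 0 x i)
  | Rec_comp n g (hs : seq (seq nat -> nat)) :
      recursive (size hs) g -> (forall h, List.In h hs -> recursive n h) ->
      recursive n (fun x => g [seq h x | h <- hs])
  | Rec_prim n f g h :
      recursive n g -> recursive n.+2 h ->
      (forall x, size x = n -> f (0 :: x) = g x) ->
      (forall x y, size x = n -> f (y.+1 :: x) = h [:: y, f (y :: x) & x]) ->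
      recursive n.+1 f
  | Rec_min n f g :
      recursive n.+1 g ->
      (forall x, size x = n ->
         g (f x :: x) = 0 /\ forall y, y < f x -> g (y :: x) <> 0) ->
      recursive n f.

(* An inference <<D_1, ..., D_m>, A, delta> is identified with its associated
   structure: the D_i are the immediate sub-structures of the latter, A is its
   conclusion and delta is given by its pointers. *)
Definition inference (D : structure) : bool :=
  wf [::] D && (if D is Infer _ _ _ then true else false).

Definition is_rule (R : structure -> Prop) : Prop :=
  (forall D, R D -> inference D) /\
  exists2 chi, recursive 1 chi &
    forall D, inference D -> (R D <-> chi [:: choice.pickle D] = 1).

Definition reduction_for (R : structure -> Prop) (phi : structure -> option structure) :
    Prop :=
  forall D D', phi D = Some D' ->
    [/\ R D, wf [::] D',
        conclusion D' = conclusion D, assumptions D' `<=` assumptions D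
      & forall s, assignment s (assumptions D) ->
          phi (subst s D) = Some (subst s D')].

Definition reductions (J : (structure -> option structure) -> Prop) : Prop :=
  forall phi, J phi -> exists2 R, is_rule R & reduction_for R phi.

(* The discharges after replacing the subtree D of a structure by D'.  An
   undischarged assumption of the sub-structure D' is a copy of an undischarged
   assumption of D with the same label, and keeps its discharge.  So does an
   application of an atomic rule in D' which is undischarged there, if the same
   rule has an undischarged application in D; otherwise it is new, hence
   undischarged.  Reductions do not tell the original from which a copy is made:
   if there are several, with different discharges, any of them may be used. *)
Definition natural_discharge (D D' : structure) : bool :=
  all (fun x => x \in open_assumptions 0 D) (open_assumptions 0 D') &&
  all (fun x =>
         has (fun y => rule_eq x.1 y.1 && (x.2 == y.2)) (open_rules 0 D)
         || ~~ has (fun y => rule_eq x.1 y.1) (open_rules 0 D) && (x.2 == None))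
      (open_rules 0 D').

Inductive replace_in (P : structure -> structure -> Prop) :
    structure -> structure -> Prop :=
  | Replace_here D D' : P D D' -> replace_in P D D'
  | Replace_above A d Ds1 D D' Ds2 :
      replace_in P D D' ->
      replace_in P (Infer A d (Ds1 ++ D :: Ds2)) (Infer A d (Ds1 ++ D' :: Ds2)).

Definition reduction_step (J : (structure -> option structure) -> Prop)
    (D D' : structure) : Prop :=
  wf [::] D' /\
  replace_in (fun E E' => natural_discharge E E' /\
                exists2 phi, J phi & phi (trunc 0 E) = Some (trunc 0 E')) D D'.

Definition reduces (J : (structure -> option structure) -> Prop) :
    structure -> structure -> Prop :=
  clos_refl_trans structure (reduction_step J).

(** * Validity *)

Definition canonical (D : structure) : bool :=
  match D with
  | Infer (And A B) _ [:: E; F] =>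
      [&& conclusion E == A, conclusion F == B,
          nilp (discharged_at 0 E) & nilp (discharged_at 0 F)]
  | Infer (Or A B) _ [:: E] =>
      ((conclusion E == A) || (conclusion E == B)) && nilp (discharged_at 0 E)
  | Infer (Imp A B) _ [:: E] =>
      (conclusion E == B) && all (pred1 A) (discharged_at 0 E)
  | _ => false
  end.

Definition immediate (D : structure) : seq structure :=
  if D is Infer _ _ Ds then [seq trunc 0 E | E <- Ds] else [::].

(* Validity on B of <D, J> for closed D with conclusion A.  In a canonical closed
   structure for X -> Y, the immediate sub-structure is closed or from {X}.
   Lemma [validP] below gives the defining clauses in their usual uniform form. *)
Fixpoint closed_valid (n : nat) (A : formula)
    (J : (structure -> option structure) -> Prop) (B : base) (D : structure) {struct A} :
    Prop :=
  match A with
  | Atom _ => exists2 E, reduces J D E & derivation B [::] E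
  | And X Y =>
      exists E, reduces J D E /\ canonical E /\
        exists E1 E2, [/\ immediate E = [:: E1; E2],
          closed_valid n X J B E1 & closed_valid n Y J B E2]
  | Or X Y =>
      exists E, reduces J D E /\ canonical E /\
        exists E1, immediate E = [:: E1] /\
          (conclusion E1 = X /\ closed_valid n X J B E1 \/
           conclusion E1 = Y /\ closed_valid n Y J B E1)
  | Imp X Y =>
      exists E, reduces J D E /\ canonical E /\
        exists E1, immediate E = [:: E1] /\
          if closed E1 then closed_valid n Y J B E1 else
          forall F J' C,
            wf [::] F -> closed F -> conclusion F = X ->
            reductions J' -> (forall phi, J phi -> J' phi) -> extends n C B ->
            closed_valid n X J' C F ->
            closed_valid n Y J' C (subst (fun=> F) E1)
  end.

Definition valid (n : nat) (J : (structure -> option structure) -> Prop) (B : base)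
    (D : structure) : Prop :=
  if closed D then closed_valid n (conclusion D) J B D else
  forall s J' C,
    assignment s (assumptions D) -> (forall A, A \in assumptions D -> closed (s A)) ->
    reductions J' -> (forall phi, J phi -> J' phi) -> extends n C B ->
    (forall A, A \in assumptions D -> closed_valid n A J' C (s A)) ->
    closed_valid n (conclusion D) J' C (subst s D).

Definition a_consequence (n : nat) (B : base) (G : {fset formula}) (A : formula) : Prop :=
  exists D J, [/\ wf [::] D, reductions J, assumptions D = G, conclusion D = A
                & valid n J B D].

(** ** The defining clauses of validity *)

Lemma outer_add m k d :
  outer (m + k) d = obind (outer k) (outer m d).
Proof.
case: d => [j|] //=; have [jm|mj] := ltnP j m; first by rewrite ltn_addr.
by rewrite /= ltn_subLR // subnDA.
Qed.

Lemma open_assumptions_add k D m x :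
  x \in open_assumptions (m + k) D ->
  exists2 o, (x.1, o) \in open_assumptions m D & outer k o = Some x.2.
Proof.
elim/structure_nested_ind: D m => [A f|A d Ds IH] m /=.
  rewrite outer_add; case: (outer m f) => //= o.
  case E: (outer k o) => [o'|] //; rewrite inE => /eqP -> /=.
  by exists o => //; rewrite inE.
elim: Ds IH => //= D Ds IHDs IH; rewrite mem_cat => /orP[].
  rewrite -addSn => /IH[|o xo ?]; first by left.
  by exists o; rewrite // mem_cat xo.
move=> /IHDs[E HE|o xo ?]; first by apply: IH; right.
by exists o; rewrite // mem_cat xo orbT.
Qed.

Lemma open_assumptions_addI k D m A o o' :
  (A, o) \in open_assumptions m D -> outer k o = Some o' ->
  (A, o') \in open_assumptions (m + k) D.
Proof.
elim/structure_nested_ind: D m => [B f|B d Ds IH] m /=.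
  rewrite outer_add; case: (outer m f) => //= p.
  by rewrite inE => /eqP[-> ->] ->; rewrite inE.
elim: Ds IH => //= D Ds IHDs IH; rewrite !mem_cat => /orP[] H Ho.
  by rewrite -addSn IH //; left.
by rewrite IHDs ?orbT // => E HE; apply: IH; right.
Qed.

Lemma mem_open_assumptions D A :
  (A \in assumptions D) = (A \in [seq x.1 | x <- open_assumptions 0 D]).
Proof.
apply/imfsetP/mapP => [[x /= xD ->]|[x xD ->]]; first by exists x.
by exists x.
Qed.

Lemma conclusion_trunc k D : conclusion (trunc k D) = conclusion D.
Proof. by case: D. Qed.

Lemma open_assumptions_trunc k D :
  [seq x.1 | x <- open_assumptions k (trunc k D)] =
  [seq x.1 | x <- open_assumptions k D].
Proof.
elim/structure_nested_ind: D k => [A f|A d Ds IH] k /=.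
  by case: f => //= j; case: (ltnP j k) => //= ->.
rewrite !map_flatten -!map_comp; congr flatten.
elim: Ds IH => //= E Es IHs IH; congr (_ :: _); first by apply: IH; left.
by apply: IHs => D HD; apply: IH; right.
Qed.

Lemma discharged_open D k A j :
  (A, Some j) \in open_assumptions k D -> A \in discharged_at (k + j) D.
Proof.
elim/structure_nested_ind: D k => [B f|B d Ds IH] k /=.
  case: f => [i|] /=; last by rewrite inE => /eqP[].
  case: (ltnP i k) => ki //.
  by rewrite inE => /eqP[-> ->]; rewrite subnKC // eqxx inE.
elim: Ds IH => //= E Es IHs IH; rewrite !mem_cat => /orP[H|H].
  by rewrite -addSn IH //; left.
by rewrite IHs ?orbT // => D HD; apply: IH; right.
Qed.

Lemma replace_in_sound J D D' : reductions J ->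
  replace_in (fun E E' => natural_discharge E E' /\
                exists2 phi, J phi & phi (trunc 0 E) = Some (trunc 0 E')) D D' ->
  conclusion D' = conclusion D /\
  forall k, {subset open_assumptions k D' <= open_assumptions k D}.
Proof.
move=> HJ; elim=> {D D'} [D D' [/andP[/allP nat _] [phi Jphi E]]|].
  have [R _ /(_ _ _ E)[_ _ + _ _]] := HJ _ Jphi.
  rewrite !conclusion_trunc => ->; split=> // k [A o].
  rewrite -[k]add0n => /open_assumptions_add[o' /= H Ho].
  exact: open_assumptions_addI (nat _ H) Ho.
move=> A d Ds1 D D' Ds2 _ [_ IH]; split=> //= k x.
rewrite !map_cat !flatten_cat /= !mem_cat => /or3P[->//|/IH->|->]; by rewrite ?orbT.
Qed.

Lemma reduces_sound J D D' : reductions J -> reduces J D D' ->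
  conclusion D' = conclusion D /\ (closed D -> closed D').
Proof.
move=> HJ; elim=> {D D'} [D D' [_ /(replace_in_sound HJ)[-> sub]]|//|].
  split=> //; rewrite /closed => /eqP D0; apply/eqP/fsetP => A.
  rewrite in_fset0 mem_open_assumptions; apply/mapP => -[x /sub xD _].
  have: x.1 \in assumptions D by rewrite mem_open_assumptions map_f.
  by rewrite D0.
by move=> D E F _ [-> ?] _ [-> ?]; split=> // H; auto.
Qed.

Lemma conclusion_subst s D : assignment s (assumptions D) ->
  conclusion (subst s D) = conclusion D.
Proof.
case: D => [A [k|]|] //= /(_ A); rewrite mem_open_assumptions /= mem_head.
by case.
Qed.

Lemma wf_open env D x : wf env D -> x \in open_assumptions (size env) D -> x.2 = None.
Proof.
elim/structure_nested_ind: D env => [A [j|]|A d Ds IH] env /=.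
- by move->.
- by rewrite inE => _ /eqP->.
case/andP=> _; move: (rule_node _ _) => b; elim: Ds IH => //= E Es IHs IH /andP[wE wEs].
rewrite mem_cat => /orP[H|]; last by apply: IHs => // D HD; apply: IH; right.
by apply: (IH E _ (b :: env)) => //; left.
Qed.

Lemma closed_open0 D k : wf [::] D -> closed D -> open_assumptions k D = [::].
Proof.
move=> wD /eqP D0; have: open_assumptions 0 D = [::].
  case E: (open_assumptions 0 D) => [//|x l].
  have: x.1 \in assumptions D by rewrite mem_open_assumptions E mem_head.
  by rewrite D0.
case E: (open_assumptions k D) => [//|[A o] l] D00.
have: (A, o) \in open_assumptions (0 + k) D by rewrite add0n E mem_head.
by case/open_assumptions_add => o'; rewrite D00.
Qed.

Lemma closed_subst s D : wf [::] D -> assignment s (assumptions D) ->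
  (forall A, A \in assumptions D -> closed (s A)) -> closed (subst s D).
Proof.
move=> wD sD clD; apply/eqP/fsetP => A; rewrite in_fset0.
rewrite mem_open_assumptions; apply/mapP => -[x + _].
have {sD clD} H B k : (B, None) \in open_assumptions 0 D ->
    open_assumptions k (s B) = [::].
  move=> BD; have BD' : B \in assumptions D.
    by rewrite mem_open_assumptions; apply/mapP; exists (B, None).
  by case: (sD _ BD') => ? _; apply: closed_open0 (clD _ BD').
move: wD H; rewrite -[0]/(size (@nil bool)); move: (@nil bool) => env.
elim/structure_nested_ind: D env => {A} [A [j|]|A d Ds IH] env /=.
- by move->.
- by move=> _ ->; rewrite // mem_head.
case/andP=> _; move: (rule_node _ _) => b; elim: Ds IH => //= E Es IHs IH /andP[wE wEs] H.
rewrite mem_cat => /orP[|].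
  apply: (IH E _ (b :: env)) => //; first by left.
  by move=> B k BE; apply: H; rewrite mem_cat BE.
apply: IHs => // [D HD|B k BE]; first by apply: IH; right.
by apply: H; rewrite mem_cat BE orbT.
Qed.

Lemma eq_subst_trunc s s' k D :
  (forall A, A \in [seq x.1 | x <- open_assumptions k D] -> s A = s' A) ->
  subst s (trunc k D) = subst s' (trunc k D).
Proof.
elim/structure_nested_ind: D k => [A [j|]|A d Ds IH] k /=.
- by case: (ltnP j k) => //= _; apply; rewrite mem_head.
- by apply; rewrite mem_head.
move=> H; congr (Infer _ _ _).
elim: Ds IH H => //= E Es IHs IH H; congr (_ :: _).
  apply: IH; first by left.
  by move=> B BE; apply: H; rewrite map_cat mem_cat BE.
apply: IHs => // [D HD|B BE]; first by apply: IH; right.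
by apply: H; rewrite map_cat mem_cat BE orbT.
Qed.

Lemma mem_immediate E F :
  List.In F (immediate E) ->
  exists2 F', F = trunc 0 F' & List.In F' (if E is Infer _ _ Ds then Ds else [::]).
Proof.
case: E => //= _ _ Ds; elim: Ds => //= D Ds IH [<-|/IH[F' -> ?]].
  by exists D => //; left.
by exists F' => //; right.
Qed.

Lemma mem_open_trunc A F :
  A \in assumptions (trunc 0 F) -> exists o, (A, o) \in open_assumptions 0 F.
Proof.
rewrite mem_open_assumptions open_assumptions_trunc => /mapP[[B o] H /= ->].
by exists o.
Qed.

Lemma canonical_immediate E F A :
  closed E -> canonical E -> List.In F (immediate E) ->
  A \in assumptions F -> exists Y, conclusion E = Imp A Y.
Proof.
move=> clE canE /mem_immediate[F' -> {F}] inF /mem_open_trunc[o Ho].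
case: E clE canE inF => //= B d Ds clE.
have E0 : open_assumptions 0 (Infer B d Ds) = [::].
  case E: (open_assumptions _ _) => [//|x l].
  have: x.1 \in assumptions (Infer B d Ds).
    by rewrite mem_open_assumptions E mem_head.
  by rewrite (eqP clE).
have dis : List.In F' Ds -> A \in discharged_at 0 F'.
  move=> inF; case: o Ho => [[|j]|] Ho.
  - by have := discharged_open Ho; rewrite add0n.
  - suff : (A, Some j) \in open_assumptions 0 (Infer B d Ds) by rewrite E0.
    rewrite /= -[1]add0n; apply/flattenP; exists (open_assumptions 1 F').
      elim: Ds inF {clE E0} => //= D Ds IH [->|/IH]; rewrite inE ?eqxx // => ->.
      by rewrite orbT.
    by rewrite -[1]add0n; apply: open_assumptions_addI Ho _; rewrite /= subn1.
  - suff : (A, None) \in open_assumptions 0 (Infer B d Ds) by rewrite E0.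
    rewrite /= -[1]add0n; apply/flattenP; exists (open_assumptions 1 F').
      elim: Ds inF {clE E0} => //= D Ds IH [->|/IH]; rewrite inE ?eqxx // => ->.
      by rewrite orbT.
    by rewrite -[1]add0n; apply: open_assumptions_addI Ho _.
case: B {clE E0} => // X Y; case: Ds dis => [|E1 [|E2 [|]]] // dis.
- case/and4P=> _ _ /nilP n1 /nilP n2 inF; have := dis inF.
  by case: inF => [<-|[<-|[]]]; rewrite ?n1 ?n2.
- by case/andP=> _ /nilP n1 inF; have := dis inF; case: inF => [<-|[]]; rewrite n1.
- case/andP=> _ /allP h inF; have := dis inF; case: inF => [<-|[]] // /h /eqP->.
  by exists Y.
Qed.

Lemma validP n J B D : wf [::] D -> reductions J ->
  (valid n J B D <->
   if closed D then
     if is_atom (conclusion D) then exists2 E, reduces J D E & derivation B [::] E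
     else exists2 E, reduces J D E /\ canonical E &
            forall F, List.In F (immediate E) -> valid n J B F
   else
     forall s J' C,
       assignment s (assumptions D) ->
       (forall A, A \in assumptions D -> closed (s A)) ->
       reductions J' -> (forall phi, J phi -> J' phi) -> extends n C B ->
       (forall A, A \in assumptions D -> valid n J' C (s A)) ->
       valid n J' C (subst s D)).
Proof.
move=> wD HJ; have [clD|opD] := boolP (closed D); last first.
  rewrite {1}/valid (negPf opD).
  have eqv s J' C : assignment s (assumptions D) ->
       (forall A, A \in assumptions D -> closed (s A)) ->
     (valid n J' C (subst s D) <-> closed_valid n (conclusion D) J' C (subst s D)) /\
     ((forall A, A \in assumptions D -> valid n J' C (s A)) <->
      (forall A, A \in assumptions D -> closed_valid n A J' C (s A))).
    move=> sD scl; rewrite /valid closed_subst // conclusion_subst //.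
    by split=> //; split=> H A AD; have := H A AD; rewrite scl //; case: (sD A AD) => _ ->.
  by split=> H s J' C sD scl HJ' JJ' BC val; have [e1 e2] := eqv s J' C sD scl;
    apply/e1; apply: H => //; apply/e2.
rewrite /valid clD; case cD: (conclusion D) => [a|X Y|X Y|X Y] //=.
- split=> [[E [DE [canE [E1 [E2 [imE v1 v2]]]]]]|[E [DE canE] H]].
  + have [cE /(_ clD) clE] := reduces_sound HJ DE.
    exists E => // F inF; have clF : closed F.
      apply/eqP/fsetP => A; rewrite in_fset0; apply/negP => AF.
      by have [Z] := canonical_immediate clE canE inF AF; rewrite cE cD.
    rewrite clF; move: inF; rewrite imE; move: canE imE cE; rewrite cD.
    case: E {DE clE} => [//|[]//= X' Y' _ [|F1 [|F2 []]]] //=.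
    case/and4P=> /eqP c1 /eqP c2 _ _ [? ?] [? ?]; subst.
    by case=> [<-|[<-|[]]]; rewrite conclusion_trunc ?c1 ?c2.
  + have [cE /(_ clD) clE] := reduces_sound HJ DE.
    exists E; split=> //; split=> //.
    have {}H F : List.In F (immediate E) -> closed_valid n (conclusion F) J B F.
      move=> inF; have := H _ inF; rewrite (_ : closed F) //.
      apply/eqP/fsetP => A; rewrite in_fset0; apply/negP => AF.
      by have [Z] := canonical_immediate clE canE inF AF; rewrite cE cD.
    move: canE H cE; rewrite cD.
    case: E {DE clE} => [//|[]//= X' Y' _ [|F1 [|F2 []]]] //=.
    case/and4P=> /eqP c1 /eqP c2 _ _ H [<- <-]; exists (trunc 0 F1), (trunc 0 F2).
    split=> //; [have := H (trunc 0 F1)|have := H (trunc 0 F2)];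
      by rewrite conclusion_trunc ?c1 ?c2; apply; auto.
- split=> [[E [DE [canE [E1 [imE v]]]]]|[E [DE canE] H]].
  + have [cE /(_ clD) clE] := reduces_sound HJ DE.
    exists E => // F inF; have clF : closed F.
      apply/eqP/fsetP => A; rewrite in_fset0; apply/negP => AF.
      by have [Z] := canonical_immediate clE canE inF AF; rewrite cE cD.
    rewrite clF; move: inF; rewrite imE => -[<-|[]//].
    by case: v => -[<-].
  + have [cE /(_ clD) clE] := reduces_sound HJ DE.
    exists E; split=> //; split=> //.
    have {}H F : List.In F (immediate E) -> closed_valid n (conclusion F) J B F.
      move=> inF; have := H _ inF; rewrite (_ : closed F) //.
      apply/eqP/fsetP => A; rewrite in_fset0; apply/negP => AF.
      by have [Z] := canonical_immediate clE canE inF AF; rewrite cE cD.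
    move: canE H cE; rewrite cD.
    case: E {DE clE} => [//|[]//= X' Y' _ [|F1 []]] //=.
    case/andP=> /orP c _ H [<- <-]; exists (trunc 0 F1); split=> //.
    have := H (trunc 0 F1); rewrite conclusion_trunc.
    by case: c => /eqP c; rewrite c => H'; [left|right]; split=> //; apply: H'; left.
- split=> [[E [DE [canE [E1 [imE v]]]]]|[E [DE canE] H]].
  + have [cE /(_ clD) clE] := reduces_sound HJ DE.
    exists E => // F inF.
    have sub A : A \in assumptions F -> A = X.
      by move=> /(canonical_immediate clE canE inF)[Z]; rewrite cE cD => -[->].
    move: inF; rewrite imE => -[eF|[]//]; subst F.
    have cE1 : conclusion E1 = Y.
      move: canE imE cE; rewrite cD {DE clE}.
      case: E => [//|[]//= X' Y' _ [|F1 []]] //= /andP[/eqP c1 _] [<-] [_ <-].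
      by rewrite conclusion_trunc.
    rewrite cE1; case: ifP v => // opE1 v s J' C sE scl HJ' JJ' BC val.
    have XE : X \in assumptions E1.
      case: (fset_0Vmem (assumptions E1)) => [E0|[A AE]]; last by rewrite -(sub A).
      by rewrite /closed E0 eqxx in opE1.
    have [wX cX] := sE X XE.
    have := v (s X) J' C wX (scl X XE) cX HJ' JJ' BC (val X XE).
    rewrite (_ : subst _ E1 = subst s E1) //.
    case: E imE {DE canE cE clE} => //= Z d [|F1 []]//= [eE1].
    rewrite -eE1 in sub *; apply: eq_subst_trunc => A.
    by rewrite -open_assumptions_trunc -mem_open_assumptions => /sub->.
  + have [cE /(_ clD) clE] := reduces_sound HJ DE.
    exists E; split=> //; split=> //.
    have sub F A : List.In F (immediate E) -> A \in assumptions F -> A = X.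
      by move=> inF /(canonical_immediate clE canE inF)[Z]; rewrite cE cD => -[->].
    move: canE sub H cE; rewrite cD {DE clE}.
    case: E => [//|[]//= X' Y' _ [|F1 []]] //= /andP[/eqP c1 _] sub H [_ eY].
    rewrite eY in c1; exists (trunc 0 F1); split=> //.
    have := H (trunc 0 F1) (or_introl erefl).
    case: ifP => clF1; rewrite conclusion_trunc c1 // => v F J' C wF clF cF HJ' JJ' BC val.
    have mX A : A \in assumptions (trunc 0 F1) -> A = X by apply: sub; left.
    by apply: (v (fun=> F)) => // A /mX-> //; rewrite clF cF.
Qed.

(* Main.v *)
Require Import Defs.
From mathcomp Require Import all_boot finmap.
From Stdlib Require Import Classical Relation_Operators.
From Stdlib Require List.

(** Both implications fail for one base and one formula X = s -> p \/ q.

    Consider the Kripke model with a root forcing no atom and two incomparable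
    worlds above it, one forcing s, t, p and the other s, t, q.  Let the base
    consist of all the rules that discharge axioms only and are sound in this
    model.  It has level 2, it contains the rules (s, [p]a, [q]a)/a for every
    atom a, ([s]p)/t and ([s]q)/t, and it does not derive t, which the root does
    not force ([soundness]).

    - In Sandqvist's semantics X holds on the base, because the rules
      (s, [p]a, [q]a)/a perform the elimination of p \/ q from s towards every
      atom a ([s_valid_split]).

    - In the reducibility semantics a valid argument for p \/ q reduces to a
      canonical one, so that p or q is derivable.  If X has a valid argument on an
      extension C of the base, then, applying it to the axiom s in the base C + s,
      either p or q is derivable in C + s; hence t is derivable in C by ([s]p)/t or
      ([s]q)/t ([valid_split]).

    So X is a consequence of no assumptions on the base in the first sense, but
    not in the second.  Conversely t is not a consequence of X on the base in the
    first sense.  It is one in the second: take for J the set of all reductions.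
    A reduction may be any partial function on closed structures that preserves
    conclusions, and reducing is a non-deterministic matter, so that with this J
    every closed structure reduces to every closed structure with the same
    conclusion ([reduces_closed]).  The one-step argument from X to t, closed by
    a valid argument for X on C, thus reduces to the derivation of t in C found
    above. *)

Set Implicit Arguments.
Unset Strict Implicit.
Unset Printing Implicit Defensive.

(** * Lists over types without decidable equality *)

Lemma has_In (T : Type) (P : pred T) (l : seq T) :
  has P l -> exists2 x, List.In x l & P x.
Proof.
elim: l => //= y l IH /orP[Py|/IH[x xl Px]]; first by exists y; [left|].
by exists x; [right|].
Qed.

Lemma all_In (T : Type) (P : pred T) (l : seq T) x :
  all P l -> List.In x l -> P x.
Proof. by elim: l => //= y l IH /andP[Py Pl] [<-|/(IH Pl)]. Qed.

Lemma In_all (T : Type) (P : pred T) (l : seq T) :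
  (forall x, List.In x l -> P x) -> all P l.
Proof.
elim: l => //= y l IH H; rewrite H; last by left.
by apply: IH => x xl; apply: H; right.
Qed.

Lemma eq_has_In (T : Type) (P Q : pred T) (l : seq T) :
  (forall x, List.In x l -> P x = Q x) -> has P l = has Q l.
Proof.
elim: l => //= y l IH H; rewrite H ?IH //; last by left.
by move=> x xl; apply: H; right.
Qed.

Lemma all2_In (T U : Type) (r : T -> U -> bool) l m x :
  all2 r l m -> List.In x l -> exists2 y, List.In y m & r x y.
Proof.
elim: l m => //= z l IH [|y m] //= /andP[rzy /IH lm] [<-|/lm[y' ym rxy]].
  by exists y; [left|].
by exists y'; [right|].
Qed.

Lemma all2_In_r (T U : Type) (r : T -> U -> bool) l m y :
  all2 r l m -> List.In y m -> exists2 x, List.In x l & r x y.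
Proof.
elim: l m => [|x l IH] [|z m] //= /andP[rxz /IH lm] [<-|/lm[x' xl rxy]].
  by exists x; [left|].
by exists x'; [right|].
Qed.

Lemma flatten_map_nil (T U : Type) (f : T -> seq U) (l : seq T) :
  flatten [seq f x | x <- l] = [::] <-> forall x, List.In x l -> f x = [::].
Proof.
elim: l => [|y l IH] /=; first by split.
split=> [|H].
  by case fy: (f y) => //= /IH H x [<-|/H].
by rewrite H ?(proj2 IH) //; [move=> x xl; apply: H; right|left].
Qed.

Lemma map_In_id (T : Type) (f : T -> T) (l : seq T) :
  (forall x, List.In x l -> f x = x) -> [seq f x | x <- l] = l.
Proof.
elim: l => //= y l IH H; rewrite H ?IH //; last by left.
by move=> x xl; apply: H; right.
Qed.

Lemma Forall2_In_r (T U : Type) (r : T -> U -> Prop) l m y :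
  List.Forall2 r l m -> List.In y m -> exists2 x, List.In x l & r x y.
Proof.
elim=> //= x z l0 m0 rxz _ IH [<-|/IH[x' xl rxy]].
  by exists x; [left|].
by exists x'; [right|].
Qed.

Lemma Forall2_In_l (T U : Type) (r : T -> U -> Prop) l m x :
  List.Forall2 r l m -> List.In x l -> exists2 y, List.In y m & r x y.
Proof.
elim=> //= z y l0 m0 rzy _ IH [<-|/IH[y' ym rxy]].
  by exists y; [left|].
by exists y'; [right|].
Qed.

(** * Transfer of derivations between bases *)

Lemma derivation_nested_ind (B : base) (P : seq (seq arule) -> structure -> Prop) :
  (forall env (ps : seq (seq arule * atom)) a d (Ds : seq structure),
    match d with
    | None => B (Rule ps a)
    | Some k => (ps = [::] \/ ~ B (Rule ps a)) /\
                has (rule_eq (Rule ps a)) (nth [::] env k)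
    end ->
    List.Forall2 (fun p E => [/\ conclusion E = Atom p.2,
      derivation B (p.1 :: env) E & P (p.1 :: env) E]) ps Ds ->
    P env (Infer (Atom a) d Ds)) ->
  forall env D, derivation B env D -> P env D.
Proof.
move=> PI; fix IH 3 => env D [{}env ps a d Ds Hd HDs].
apply: PI Hd _; elim: HDs => [|p E ps0 Ds0 [cE dE] _ IHs]; first by left.
by right=> //; split=> //; exact: IH.
Qed.

Lemma rule_eq_axiom_l a R : rule_eq (axiom a) R -> R = axiom a.
Proof. by case: R => [[|p ps] b] //= /andP[/eqP->]. Qed.

Lemma rule_eq_axiom_r a ps b : rule_eq (Rule ps b) (axiom a) -> ps = [::] /\ b = a.
Proof. by case: ps => [|p ps] /= /andP[/eqP->]. Qed.

(** A derivation in B becomes a derivation in B' if the rules of B that are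
    missing in B' are assumed, and discharged further below, by [env'].
    The assumed rules that belong to B' become applications of rules of B', for
    which a discharge is not permitted. *)
Lemma derivation_transfer (B B' : base) env' env D :
  (forall ps a, B (Rule ps a) -> B' (Rule ps a) \/
     exists k, (ps = [::] \/ ~ B' (Rule ps a)) /\
               has (rule_eq (Rule ps a)) (nth [::] env' k)) ->
  derivation B env D ->
  exists2 D', derivation B' (env ++ env') D' & conclusion D' = conclusion D.
Proof.
move=> BB'; elim/derivation_nested_ind => {D}env ps a d Ds Hd IH.
have [Ds' HDs'] : exists Ds', List.Forall2 (fun p E =>
    conclusion E = Atom p.2 /\ derivation B' (p.1 :: env ++ env') E) ps Ds'.
  elim: IH {Hd} => [|p E ps0 Ds0 [cE _ [E' dE' cE']] _ [Es HEs]].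
    by exists [::]; constructor.
  by exists (E' :: Es); constructor; rewrite ?cE'.
suff [d' Hd'] : exists d', match d' with
    | None => B' (Rule ps a)
    | Some k => (ps = [::] \/ ~ B' (Rule ps a)) /\
                has (rule_eq (Rule ps a)) (nth [::] (env ++ env') k)
    end.
  by exists (Infer (Atom a) d' Ds') => //; apply: Derivation HDs'.
case: (classic (B' (Rule ps a))) => [B'R|nB'R]; first by exists None.
case: d Hd => [k [_ Hk]|/BB'[//|[k [H Hk]]]].
  exists (Some k); split; first by right.
  have kenv : k < size env.
    by rewrite ltnNge; apply/negP => envk; rewrite nth_default in Hk.
  by rewrite nth_cat kenv.
exists (Some (size env + k)); split=> //.
by rewrite nth_cat ltnNge leq_addr /= addKn.
Qed.

Lemma derivable_mono (B C : base) a :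
  (forall R, B R -> C R) -> derivable B a -> derivable C a.
Proof.
move=> BC [D dD cD].
have BC' ps b : B (Rule ps b) -> C (Rule ps b) \/ exists k,
    (ps = [::] \/ ~ C (Rule ps b)) /\ has (rule_eq (Rule ps b)) (nth [::] [::] k).
  by move=> /BC; left.
have [D' dD' cD'] := derivation_transfer BC' dD.
by exists D' => //; rewrite cD'.
Qed.

(** The base B + a, which is B with the axiom a added. *)
Program Definition add_axiom (B : base) (a : atom) : base :=
  @Base (fun R => B R \/ R = axiom a) _ _.
Next Obligation. by left; exact: base_explosion. Qed.
Next Obligation.
case: H0 => [BR|E]; first by left; exact: base_ext BR.
by right; move: H; rewrite E => /rule_eq_axiom_l.
Qed.

Lemma add_axiom_extends n (B : base) a :
  base_level_le n B -> extends n (add_axiom B a) B.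
Proof.
move=> Bn; split=> [R BR|R [BR|-> _]] //; first by left.
exact: Bn.
Qed.

Lemma derivable_axiom (B : base) a : derivable (add_axiom B a) a.
Proof.
exists (Infer (Atom a) None [::]) => //.
by apply: (@Derivation _ _ [::]); [right|constructor].
Qed.

(** The next two lemmas provide the premises ([a]b) and ([]a) of applications of
    atomic rules. *)
Lemma derivable_discharge (B : base) a b : derivable (add_axiom B a) b ->
  exists2 D, derivation B [:: [:: axiom a]] D & conclusion D = Atom b.
Proof.
case=> D dD <-; apply: (derivation_transfer (env := [::])) dD => ps c [BR|[-> ->]].
  by left.
by right; exists 0; split; [left|rewrite /= eqxx].
Qed.

Lemma derivable_weaken (B : base) a : derivable B a ->
  exists2 D, derivation B [:: [::]] D & conclusion D = Atom a.
Proof.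
case=> D dD <-; apply: (derivation_transfer (env := [::])) dD => ps b BR.
by left.
Qed.

(** * Bases sound in a Kripke model *)

(** Intuitionistic Kripke models for atoms, with an order that need not be
    transitive, as the rules considered below discharge axioms only. *)
Record model := Model {
  world : Type;
  le : world -> world -> Prop;
  forces : world -> atom -> Prop;
  le_refl : forall w, le w w;
  forces_le : forall w v a, le w v -> forces w a -> forces v a;
  forces_bot : forall w, ~ forces w Bot
}.

Definition is_axiom (R : arule) : Prop := exists a, R = axiom a.

Definition axiom_forced (M : model) (w : world M) (R : arule) : Prop :=
  exists2 a, R = axiom a & forces w a.

(** Soundness of a rule that discharges axioms only: like an implication, a
    premise ([Rs]A) holds at w if A is forced at all v above w where the axioms in
    Rs are forced. *)
Definition sound_rule (M : model) (R : arule) : Prop :=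
  let: Rule ps a := R in
  (forall p Q, List.In p ps -> List.In Q p.1 -> is_axiom Q) /\
  forall w : world M,
    (forall p v, List.In p ps -> le w v ->
       (forall Q, List.In Q p.1 -> axiom_forced v Q) -> forces v p.2) ->
    forces w a.

Lemma sound_rule_ext M R S : rule_eq R S -> sound_rule M R -> sound_rule M S.
Proof.
case: R => ps a; case: S => qs b /= /andP[/eqP <- pqs] [axps sps].
(* A rule equivalent to an axiom is this axiom, so that the discharged axioms
   are literally the same. *)
have sub p (q : seq arule * atom) : List.In p ps ->
    all (fun s => has (fun r => rule_eq r s) p.1) q.1 ->
    forall Q, List.In Q q.1 -> List.In Q p.1.
  move=> inp Hall Q inQ; have /has_In[Q' inQ' QQ'] := all_In Hall inQ.
  have [c eQ'] := axps _ _ inp inQ'.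
  by move: QQ' (inQ'); rewrite eQ' => /rule_eq_axiom_l ->.
split=> [q Q inq inQ|w H].
  have [p inp /and3P[_ _ pq]] := all2_In_r pqs inq.
  exact: axps inp (sub _ _ inp pq _ inQ).
apply: sps => p v inp wv Hp.
have [q inq /and3P[/eqP-> _ pq]] := all2_In pqs inp.
by apply: H inq wv _ => Q /(sub _ _ inp pq)/Hp.
Qed.

Lemma sound_rule_explosion M a : sound_rule M (explosion a).
Proof.
split=> [p Q [<-|[]] []|w H]; case: (forces_bot (w := w)).
by apply: (H ([::], Bot)) => //; [left|exact: le_refl].
Qed.

(** The base of all the rules of level at most 2 that are sound in M: these are
    the rules that discharge axioms only. *)
Definition model_base (M : model) : base :=
  @Base (sound_rule M) (@sound_rule_explosion M) (@sound_rule_ext M).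

Lemma model_base_level M : base_level_le 2 (model_base M).
Proof.
move=> [ps a] [axps _] _ /=; elim: ps axps => //= p ps IH axps.
rewrite geq_max IH ?andbT => [|q Q inq]; last by apply: axps; right.
have {axps IH} : forall Q, List.In Q p.1 -> is_axiom Q.
  by move=> Q; apply: axps; left.
elim: p.1 => //= Q Qs IH axQ; rewrite geq_max IH => [|R inR].
  by have [c ->] : is_axiom Q by apply: axQ; left.
by apply: axQ; right.
Qed.

(** By induction on derivations whose assumed rules are axioms forced at the
    given world. *)
Lemma soundness M a w : derivable (model_base M) a -> forces (w : world M) a.
Proof.
case=> D dD cD.
suff : forall v : world M, (forall Rs R, List.In Rs [::] -> List.In R Rs ->
    axiom_forced v R) -> forces v (atom_of (conclusion D)).
  by rewrite cD; apply.
elim/derivation_nested_ind: dD => {a w cD}env ps a [k|] Ds Hd IH v envv /=.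
  case: Hd => _ Hk; have kenv : k < size env.
    by rewrite ltnNge; apply/negP => envk; rewrite nth_default in Hk.
  have [R inR Req] := has_In Hk.
  have [|c Rc cv] := envv (nth [::] env k) R _ inR.
    elim: env k kenv {Hk inR envv IH} => //= Rs env IH [|k]; first by left.
    by rewrite ltnS => /IH; right.
  by move: Req; rewrite Rc => /rule_eq_axiom_r[_ ->].
case: Hd => _; apply=> p v' inp vv' Hp.
have [E _ [cE _ +]] := Forall2_In_l IH inp; rewrite cE; apply=> Rs R.
case=> [<-|inRs inR]; first exact: Hp.
have [c -> cv] := envv Rs R inRs inR.
by exists c; rewrite //; exact: forces_le cv.
Qed.

(** * All reductions at once *)

Lemma trunc_wf env D : wf env D -> trunc (size env) D = D.
Proof.
elim/structure_nested_ind: D env => [A [k|] env|A d Ds IH env] //=.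
  by move=> ->.
case/andP=> Hd HDs; congr Infer.
  case: d Hd => //= k /andP[Hk _]; case: ltnP => // envk.
  by rewrite nth_default in Hk.
apply: map_In_id => E inE.
exact: IH inE (rule_node A Ds :: env) (all_In HDs inE).
Qed.

Lemma wf_cat env env' D : wf env D -> wf (env ++ env') D.
Proof.
elim/structure_nested_ind: D env => [A [k|] env|A d Ds IH env] //=.
  by rewrite size_cat => /ltn_addr.
case/andP=> Hd HDs; apply/andP; split.
  case: d Hd => //= k /andP[Hk ->]; rewrite andbT nth_cat.
  by case: ltnP => // envk; rewrite nth_default in Hk.
by apply: In_all => E inE; apply: (IH E inE (_ :: env)); exact: all_In inE.
Qed.

Lemma wf_open_rules env D x :
  wf env D -> List.In x (open_rules (size env) D) -> x.2 = None.
Proof.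
elim/structure_nested_ind: D env => [A f env|A d Ds IH env] //=.
case/andP=> Hd HDs /(@List.in_app_or _ _ _ _)[|].
  case: (rule_node A Ds) => //; case: d Hd => [k /andP[Hk _]|_] /=.
    by case: ltnP => // envk; rewrite nth_default in Hk.
  by case=> [<-|].
elim: Ds {Hd} (rule_node A Ds) IH HDs => //= E Es IHs b IH /andP[wE wEs].
case/(@List.in_app_or _ _ _ _); first by apply: (IH E _ (b :: env)) => //; left.
by apply: IHs wEs => F inF; apply: IH; right.
Qed.

Lemma subst_closed s k D : open_assumptions k D = [::] -> subst s D = D.
Proof.
elim/structure_nested_ind: D k => [A [j|] k|A d Ds IH k] //= /flatten_map_nil H.
congr Infer; apply: map_In_id => E inE.
exact: IH inE _ (H E inE).
Qed.

Lemma derivation_no_assumption B env D k : derivation B env D ->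
  discharged_at k D = [::] /\ open_assumptions k D = [::].
Proof.
move=> dD; elim/derivation_nested_ind: dD k => {D}{}env ps a d Ds _ IH k /=.
by split; apply/flatten_map_nil => E /(Forall2_In_r IH)[p _ [_ _ /(_ k.+1)[]]].
Qed.

Lemma derivation_closed B env D : derivation B env D -> Defs.closed D.
Proof.
move=> dD; apply/eqP/fsetP => A; rewrite mem_open_assumptions in_fset0.
by have [_ ->] := derivation_no_assumption 0 dD.
Qed.

Lemma derivation_wf B env D : derivation B env D -> wf (nseq (size env) true) D.
Proof.
elim/derivation_nested_ind => {D}{}env ps a d Ds Hd IH /=.
have -> : rule_node (Atom a) Ds.
  apply/and3P; split=> //; apply: In_all => E /(Forall2_In_r IH)[p _ [cE dE _]].
    by rewrite cE.
  by have [-> _] := derivation_no_assumption 0 dE.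
apply/andP; split; last first.
  by apply: In_all => E /(Forall2_In_r IH)[p _ [_ _]].
case: d Hd => // k [_ Hk]; rewrite andbT nth_nseq.
by case: ltnP => // envk; rewrite nth_default in Hk.
Qed.

(** The largest set of reductions. *)
Definition all_reductions (phi : structure -> option structure) : Prop :=
  exists2 R, is_rule R & reduction_for R phi.

(** On closed structures, the condition that reductions commute with
    substitution is void. *)
Lemma all_reductions_single D D' :
  wf [::] D -> Defs.closed D -> wf [::] D' -> Defs.closed D' ->
  conclusion D' = conclusion D ->
  all_reductions (fun E => if E == D then Some D' else None).
Proof.
move=> wD clD wD' clD' cDD'; exists inference.
  split=> //; exists (fun=> 1) => //.
  by apply: (@Rec_comp 1 _ [:: fun=> 0]) Rec_succ _ => h [<-|[]]; exact: Rec_zero.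
move=> E E'; case: eqP => // -> [<-]; split=> //.
- rewrite /inference wD; case: D wD clD {cDD'} => [A [k|]|] // _.
  by move/eqP/fsetP => /(_ A); rewrite mem_open_assumptions /= inE eqxx.
- by rewrite (eqP clD').
- by move=> s _; rewrite !(@subst_closed _ 0) ?eqxx //; exact: closed_open0.
Qed.

Lemma reduces_closed D D' :
  wf [::] D -> Defs.closed D -> wf [::] D' -> Defs.closed D' ->
  conclusion D' = conclusion D -> reduces all_reductions D D'.
Proof.
move=> wD clD wD' clD' cDD'; apply: rt_step; split=> //; apply: Replace_here.
split; last first.
  exists (fun E => if E == D then Some D' else None).
    exact: all_reductions_single.
  by rewrite (trunc_wf wD) (trunc_wf wD') eqxx.
(* Nothing is discharged outside of a whole structure, so the applications of
   atomic rules that are open in D and D' all have the discharge [None]. *)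
rewrite /natural_discharge (closed_open0 0 wD' clD') /=.
apply: In_all => x /(wf_open_rules wD')->; rewrite eqxx andbT.
have -> : has (fun y => rule_eq x.1 y.1 && (None == y.2)) (open_rules 0 D) =
          has (fun y => rule_eq x.1 y.1) (open_rules 0 D).
  by apply: eq_has_In => y /(wf_open_rules wD)->; rewrite eqxx andbT.
by rewrite orbN.
Qed.

Lemma reduces_mono (J J' : (structure -> option structure) -> Prop) D D' :
  (forall phi, J phi -> J' phi) -> reduces J D D' -> reduces J' D D'.
Proof.
move=> JJ'; elim=> {D D'} [D D' [wD' DD']|D|D D' D'' _ DD' _ D'D''].
- apply: rt_step; split=> //.
  elim: DD' => {D D' wD'} [D D' [nat [phi Jphi e]]|A d Ds1 D D' Ds2 _].
    by apply: Replace_here; split=> //; exists phi => //; exact: JJ'.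
  exact: Replace_above.
- exact: rt_refl.
- exact: rt_trans D'D''.
Qed.

(** * The counterexample *)

Definition s := Letter 0.
Definition t := Letter 1.
Definition p := Letter 2.
Definition q := Letter 3.

(** The formula X. *)
Definition split_formula : formula := Imp (Atom s) (Or (Atom p) (Atom q)).

(** [None] is the root, [Some true] forces p and [Some false] forces q. *)
Definition fork_forces (w : option bool) (a : atom) : bool :=
  if w is Some b then a \in [:: s; t; if b then p else q] else false.

Definition fork_le (w v : option bool) : Prop := w = None \/ w = v.

Lemma fork_le_refl w : fork_le w w. Proof. by right. Qed.

Lemma fork_forces_le w v a : fork_le w v -> fork_forces w a -> fork_forces v a.
Proof. by case=> ->. Qed.

Lemma fork_forces_bot w : ~ fork_forces w Bot.
Proof. by case: w => [[]|]. Qed.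

Definition fork : model := Model fork_le_refl fork_forces_le fork_forces_bot.

Definition fork_base := model_base fork.

Lemma fork_base_elim a :
  fork_base (Rule [:: ([::], s); ([:: axiom p], a); ([:: axiom q], a)] a).
Proof.
split=> [r Q [<-|[<-|[<-|[]]]] //=|].
- by case=> [<-|[]]; exists p.
- by case=> [<-|[]]; exists q.
case=> [b|] H.
  have inr : List.In ([:: axiom (if b then p else q)], a)
     [:: ([::], s); ([:: axiom p], a); ([:: axiom q], a)].
    by case: b {H} => /=; auto.
  apply: (H _ (Some b) inr) => [|Q [<-|[]]]; first by right.
  by exists (if b then p else q); rewrite //= !inE eqxx !orbT.
by have := H ([::], s) None (or_introl erefl) (or_introl erefl); apply.
Qed.

Lemma fork_base_intro b :
  fork_base (Rule [:: ([:: axiom s], if b then p else q)] t).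
Proof.
split=> [r Q [<-|[]] [<-|[]]|]; first by exists s.
case=> [c _|H]; first by rewrite /= !inE eqxx orbT.
(* The premise fails at the root because of the world above it that forces s,
   but not the conclusion of the premise. *)
have := H _ (Some (~~ b)) (or_introl erefl) (or_introl erefl).
suff : ~~ fork_forces (Some (~~ b)) (if b then p else q).
  move=> /negP nf /= Hf; case: nf; apply: Hf => Q [<-|[]].
  by exists s.
by case: b {H}.
Qed.

Lemma fork_base_underivable : ~ derivable fork_base t.
Proof. by move/(soundness (M := fork) None). Qed.

Lemma s_valid_split : s_valid 2 fork_base split_formula.
Proof.
move=> C [BC Cn] Cs E a [CE En] Hp Hq.
have [Ds dDs cDs] := derivable_weaken (derivable_mono CE Cs).
have [|Dp dDp cDp] := @derivable_discharge E p a.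
  by apply: Hp (add_axiom_extends p En) _; exact: derivable_axiom.
have [|Dq dDq cDq] := @derivable_discharge E q a.
  by apply: Hq (add_axiom_extends q En) _; exact: derivable_axiom.
exists (Infer (Atom a) None [:: Ds; Dp; Dq]) => //.
apply: Derivation; first by apply/CE/BC; exact: fork_base_elim.
by repeat constructor.
Qed.

Lemma closed_valid_atom n J B D a : reductions J -> conclusion D = Atom a ->
  closed_valid n (Atom a) J B D -> derivable B a.
Proof.
by move=> HJ cD [E /(reduces_sound HJ)[cE _] dE]; exists E; rewrite ?cE.
Qed.

Lemma closed_valid_or_atoms n J B D a b : reductions J ->
  closed_valid n (Or (Atom a) (Atom b)) J B D -> derivable B a \/ derivable B b.
Proof.
move=> HJ [E [_ [_ [E1 [_ [[c v]|[c v]]]]]]]; [left|right];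
exact: closed_valid_atom HJ c v.
Qed.

(** If the immediate sub-structure E1 of the canonical argument for X is closed,
    it already is an argument for p \/ q on C; otherwise s is assumed in it, and
    the axiom s is substituted for this assumption in C + s. *)
Lemma valid_split J C D : reductions J -> extends 2 C fork_base ->
  closed_valid 2 split_formula J C D -> derivable C t.
Proof.
move=> HJ [BC Cn] [E [_ [_ [E1 [_ v]]]]].
have Cs := add_axiom_extends s Cn.
have {v} [b Hb] : exists b : bool, derivable (add_axiom C s) (if b then p else q).
  suff [Hp|Hq] : derivable (add_axiom C s) p \/ derivable (add_axiom C s) q.
  - by exists true.
  - by exists false.
  case: (Defs.closed E1) v => [v|v].
    have [H|H] := @closed_valid_or_atoms 2 _ _ _ p q HJ v; [left|right];
    by apply: derivable_mono H; case: Cs.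
  have [Ds dDs cDs] := derivable_axiom C s.
  apply: (@closed_valid_or_atoms 2 _ _ _ p q HJ (v Ds J _ _ _ _ HJ _ Cs _)) => //.
  - exact: derivation_wf dDs.
  - exact: derivation_closed dDs.
  - by exists Ds => //; exact: rt_refl.
have [Db dDb cDb] := derivable_discharge Hb.
exists (Infer (Atom t) None [:: Db]) => //.
apply: Derivation; first by apply: BC; exact: fork_base_intro b.
by repeat constructor.
Qed.

Theorem theorem10 :
  ~ (forall (G : {fset formula}) (A : formula) (B : base), base_level_le 2 B ->
       s_consequence 2 B G A -> a_consequence 2 B G A) /\
  ~ (forall (G : {fset formula}) (A : formula) (B : base), base_level_le 2 B ->
       a_consequence 2 B G A -> s_consequence 2 B G A).
Proof.
have B2 : base_level_le 2 fork_base := @model_base_level fork.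
have BB : extends 2 fork_base fork_base by [].
split=> H; apply: fork_base_underivable.
  have [|D [J [wD HJ D0 cD v]]] := H fset0 split_formula _ B2.
    by rewrite /s_consequence eqxx; exact: s_valid_split.
  apply: (@valid_split J _ D HJ BB).
  by move: v; rewrite /valid /Defs.closed D0 eqxx cD.
have [|A] := boolP ([fset split_formula]%fset == fset0).
  by move/eqP/fsetP => /(_ split_formula); rewrite !inE eqxx.
have := H [fset split_formula]%fset (Atom t) _ B2.
rewrite /s_consequence (negPf A); apply=> //; last first.
  by move=> X; rewrite inE => /eqP->; exact: s_valid_split.
(* The step from X to t; every instance of it that is closed by a valid argument
   for X reduces to a derivation of t. *)
pose D := Infer (Atom t) None [:: Assume split_formula None].
have DX : assumptions D = [fset split_formula]%fset.
  by apply/fsetP => Y; rewrite mem_open_assumptions !inE.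
exists D, all_reductions; split=> //.
rewrite /valid /Defs.closed DX (negPf A) => s J C sX clX HJ JJ BC val.
have inX : split_formula \in [fset split_formula]%fset by rewrite inE.
have [wX _] := sX _ inX.
have [E dE cE] := valid_split HJ BC (val _ inX).
exists E => //.
have wE : wf [::] E := derivation_wf dE.
have clE := derivation_closed dE.
have red : reduces all_reductions (subst s D) E.
  apply: reduces_closed => //.
    by rewrite /= andbT; exact: (@wf_cat [::]).
  by apply: closed_subst => //; rewrite DX.
exact: reduces_mono red.
Qed.
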